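(* Let $\boldsymbol X$ be a graphical model relative to a decomposable (chordal) graph $\mathcal G=(V,E)$, with standard Fréchet$(1)$ marginal distributions. Then, for any two maximal cliques $C$ and $C'$ (with $C\ne C'$) for which $C\cap C'=S\neq\emptyset$ and such that the limit $\lim_{t\to\infty}t\,\mathbb P(\boldsymbol X_S/t\in[\boldsymbol 0,\boldsymbol x_S]^c)$ exists, $$\lim_{t\to\infty}t\,\mathbb P\left(\boldsymbol X_C/t\in B\right)=\lim_{t\to\infty}t\,\mathbb P\left(\boldsymbol X_{C'}/t\in B'\right)$$ for the two sets $B=\mathbb E^{C\setminus S}\times[\boldsymbol 0,\boldsymbol x_S]^c$ and $B'=\mathbb E^{C'\setminus S}\times[\boldsymbol 0,\boldsymbol x_S]^c$.
   Context: For $A\subseteq V=\{1,\dots,d\}$, $\boldsymbol x_A=(x_u:u\in A)$ and $\mathbb E^A=[0,\infty)^A\setminus\{\boldsymbol 0\}$. Here $\boldsymbol x_S$ is a vector in $(0,\infty)^S$ and $[\boldsymbol 0,\boldsymbol x_S]^c$ is the complement of the box in $[0,\infty)^S$. Standard Fréchet$(1)$ margins: $\mathbb P(X_u\le x)=\exp(-1/x)$, $x>0$, for all $u\in V$. Graphs are finite, undirected, without loops or parallel edges; a graph is decomposable (chordal) if every cycle of length at least four has an edge joining two non-consecutive vertices of the cycle. $\boldsymbol X$ is a graphical model relative to $\mathcal G$ if $X_i$ and $X_j$ are conditionally independent given $\boldsymbol X_{V\setminus\{i,j\}}$ for all $i\neq j$ with $(i,j)\notin E$. *)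

(* Defs.v *)
From HB Require Import structures.
From mathcomp Require Import all_boot all_order all_algebra.
From mathcomp Require Import all_classical all_reals all_analysis.

Set Implicit Arguments.
Unset Strict Implicit.
Unset Printing Implicit Defensive.

Import Order.TTheory GRing.Theory Num.Theory.
Import numFieldNormedType.Exports.

Local Open Scope classical_set_scope.
Local Open Scope ring_scope.

Section Graphs.
Context {V : finType}.
Implicit Types (e : rel V) (K : {set V}).

Definition simple_graph e : Prop := symmetric e /\ irreflexive e.

Definition clique e K : bool :=
  [forall u in K, forall v in K, (u != v) ==> e u v].

Definition maximal_clique e K : bool := maxset (clique e) K.

(* [ucycle e c]: [c] lists, without repetition, the vertices of a cycle of the
   graph; [next c u] is the vertex following [u] along it. *)
Definition decomposable e : Prop :=
  forall c : seq V, ucycle e c -> (4 <= size c)%N ->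
  exists u v : V, [/\ u \in c, v \in c, e u v, next c u != v & next c v != u].

End Graphs.

Section ConditionalIndependence.
Context {disp : measure_display} {T : measurableType disp} {R : realType}.
Implicit Types (P : probability T R) (F : set_system T).

(* [f] is a version of the conditional probability of [E] given the
   sigma-algebra [F]. *)
Definition is_cond_prob P F (E : set T) (f : T -> R) : Prop :=
  [/\ forall B : set R, measurable B -> F (f @^-1` B),
      P.-integrable setT (EFin \o f) &
      forall D : set T, F D ->
        (\int[P]_(w in D) (f w)%:E = P (E `&` D))%E].

(* Versions of a conditional probability exist and are almost surely unique,
   so asking for some triple of versions or for all of them is the same. *)
Definition cond_indep P F (Y Z : T -> R) : Prop :=
  forall A B : set R, measurable A -> measurable B ->
  exists f g h : T -> R,
    [/\ is_cond_prob P F (Y @^-1` A) f,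
        is_cond_prob P F (Z @^-1` B) g,
        is_cond_prob P F (Y @^-1` A `&` Z @^-1` B) h &
        {ae P, forall w, h w = f w * g w}].

End ConditionalIndependence.

Section RandomVectors.
Context {disp : measure_display} {T : measurableType disp} {R : realType}.
Context {V : finType} {P : probability T R}.
Implicit Types (X : V -> {RV P >-> R}) (A : {set V}).

(* The sigma-algebra generated by the subvector of [X] indexed by [A]. *)
Definition sigma_subvec X A : set_system T :=
  <<s [set E | exists u : V, u \in A /\
               exists2 B : set R, measurable B & E = X u @^-1` B] >>.

Definition graphical_model (e : rel V) X : Prop :=
  forall i j : V, i != j -> ~~ e i j ->
    cond_indep P (sigma_subvec X (~: [set i; j])%SET) (X i) (X j).

(* [cdf Y x] is the probability that [Y <= x]. *)
Definition standard_frechet1 (Y : {RV P >-> R}) : Prop :=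
  forall x : R, 0 < x -> cdf Y x = (expR (- x^-1))%:E.

End RandomVectors.

Section Vectors.
Context {R : realType} {V : finType}.
Implicit Types (A B C S : {set V}).

Definition subvec A : Type := {u : V | u \in A} -> R.

Definition restr A B (sAB : A \subset B) (y : subvec B) : subvec A :=
  fun u => y (exist _ (val u) (fintype.subsetP sAB (val u) (valP u))).

(* [0, oo)^A *)
Definition orthant A : set (subvec A) := [set y | forall u, 0 <= y u].
Arguments orthant A : clear implicits.

Definition punctured_orthant A : set (subvec A) :=
  orthant A `\` [set fun=> 0].
Arguments punctured_orthant A : clear implicits.

(* The box with corners 0 and x, and its complement in [0, oo)^S. *)
Definition box S (x : subvec S) : set (subvec S) :=
  [set y | forall u, 0 <= y u <= x u].

Definition box_compl S (x : subvec S) : set (subvec S) := orthant S `\` box x.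

(* The product of [punctured_orthant (C :\: S)] and [box_compl x], under the
   identification of R^C with R^(C \ S) x R^S. *)
Definition extremal_set S C (sSC : S \subset C) (x : subvec S) :
    set (subvec C) :=
  [set y | punctured_orthant (C :\: S) (restr (finset.subsetDl C S) y) /\
           box_compl x (restr sSC y)].

End Vectors.
Arguments subvec R {V} A.

Section Tail.
Context {disp : measure_display} {T : measurableType disp} {R : realType}.
Context {V : finType} {P : probability T R}.

Definition scaled_subvec (X : V -> {RV P >-> R}) (A : {set V}) (t : R) (w : T) :
  subvec R A := fun u => X (val u) w / t.

(* t P(X_A / t \in B) *)
Definition scaled_tail (X : V -> {RV P >-> R}) (A : {set V})
    (B : set (subvec R A)) (t : R) : R :=
  t * fine (P [set w | B (scaled_subvec X t w)]).

End Tail.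

(* Main.v *)
(* A maximal clique C different from C' has a vertex outside S.
   Frechet margins are almost surely positive, so X_(C \ S) / t almost surely lies in
   E^(C \ S).  Hence both events coincide almost surely with
   {X_S / t \in [0, x_S]^c}. *)
Require Import Defs.
From HB Require Import structures.
From mathcomp Require Import all_boot all_order all_algebra.
From mathcomp Require Import all_classical all_reals all_analysis.

Set Implicit Arguments.
Unset Strict Implicit.
Unset Printing Implicit Defensive.

Import Order.TTheory GRing.Theory Num.Theory.
Import numFieldNormedType.Exports.

Local Open Scope classical_set_scope.
Local Open Scope ring_scope.

Section FrechetTails.
Context {disp : measure_display} {T : measurableType disp} {R : realType}.
Context {P : probability T R}.

Lemma measurable_forall (I : finType) (A : I -> set T) :
  (forall i, measurable (A i)) -> measurable [set w | forall i, A i w].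
Proof.
move=> mA; rewrite (_ : [set w | _] = \bigcap_(i in [set: I]) A i); last first.
  by apply/seteqP; split => w Aw i => [_|]; exact: Aw.
by apply: fin_bigcap_measurable => // i _; exact: mA.
Qed.

Lemma RV_leE (Y : {RV P >-> R}) (r : R) :
  [set w | Y w <= r] = Y @^-1` `]-oo, r].
Proof. by apply/seteqP; split => w /=; rewrite in_itv. Qed.

Lemma measurable_RV_le (Y : {RV P >-> R}) (r : R) :
  measurable [set w | Y w <= r].
Proof. by rewrite RV_leE; exact: measurable_funPTI. Qed.

(* exp(-1/p) < p for all p > 0, so P(Y <= 0) <= P(Y <= p) forces P(Y <= 0) = 0:
   take p = P(Y <= 0). *)
Lemma standard_frechet1_le0 (Y : {RV P >-> R}) :
  standard_frechet1 Y -> P [set w | Y w <= 0] = 0%E.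
Proof.
move=> Yfr.
have cdfE r : cdf Y r = P [set w | Y w <= r].
  by rewrite /cdf /distribution /pushforward -RV_leE.
pose p := fine (P [set w | Y w <= 0]).
have pE : P [set w | Y w <= 0] = p%:E by rewrite fineK// fin_num_measure//; exact: measurable_RV_le.
have p_ge0 : 0 <= p by apply: fine_ge0.
rewrite pE; congr EFin; apply/eqP; rewrite eq_le p_ge0 andbT leNgt.
apply/negP => p_gt0.
have : (P [set w | (Y w <= 0)%R] <= P [set w | (Y w <= p)%R])%E.
  apply: le_measure => [||w /= Yw]; rewrite ?inE; try exact: measurable_RV_le.
  exact: le_trans Yw p_ge0.
rewrite -(cdfE p) (Yfr _ p_gt0) pE lee_fin expRN leNgt => /negP; apply.
(* Taking inverses turns exp(-1/p) < p into 1/p < exp(1/p), which follows from 1 + y <= exp(y) at y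
   = 1/p. *)
rewrite invf_plt ?posrE ?expR_gt0//.
by apply: lt_le_trans (expR_ge1Dx _); rewrite ltrDr.
Qed.

Context {V : finType}.
Implicit Type X : V -> {RV P >-> R}.

(** Measurability is checked on the sample space one coordinate at a time, so that no sigma-algebra
    on [subvec] is needed; finiteness of [V] then handles the events that quantify over
    coordinates. *)
Lemma measurable_scaled X (A : {set V}) (t : R) (u : {u | u \in A})
    (D : set R) :
  measurable D -> measurable [set w | D (scaled_subvec X t w u)].
Proof.
move=> mD; have mf : measurable_fun setT (fun w => X (val u) w / t).
  exact: measurableT_comp (measurable_realfun.mulrr_measurable _) _.
by have := mf measurableT D mD; rewrite setTI.
Qed.

Lemma measurable_scaled_ge0 X (A : {set V}) (t : R) :
  measurable [set w | @orthant R V A (scaled_subvec X t w)].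
Proof.
apply: measurable_forall => u.
have := measurable_scaled X t u (measurable_itv `[0, +oo[).
by congr measurable; apply/seteqP; split => w /=; rewrite in_itv/= andbT.
Qed.

Lemma measurable_scaled_box_compl X (S : {set V}) (x : subvec R S) (t : R) :
  measurable [set w | box_compl x (scaled_subvec X t w)].
Proof.
apply: measurableD; first exact: measurable_scaled_ge0.
apply: measurable_forall => u.
have := measurable_scaled X t u (measurable_itv `[0, x u]).
by congr measurable; apply/seteqP; split => w /=; rewrite in_itv/=.
Qed.

Lemma measurable_scaled_extremal X (S C : {set V}) (sSC : S \subset C)
    (x : subvec R S) (t : R) :
  measurable [set w | extremal_set sSC x (scaled_subvec X t w)].
Proof.
apply: measurableI; last exact: (measurable_scaled_box_compl X x t).
apply: measurableD; first exact: (measurable_scaled_ge0 X (C :\: S)%SET t).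
(* Being the zero vector is an equality of functions; it is split into finitely many scalar
   conditions. *)
rewrite [X in measurable X](_ : _ = [set w | forall u : {u | u \in (C :\: S)%SET},
    [set 0] (scaled_subvec X t w u)]).
  by apply: measurable_forall => u; exact: measurable_scaled.
apply/seteqP; split => w /= w0; last by apply/funext => u; exact: w0.
by move=> u; move/(congr1 (fun f => f u)): w0.
Qed.

(** The equality is exact at each t > 0, before any limit. If [S] were equal to [C], the only vector
    indexed by [C :\: S] would be the zero vector, and the left-hand event would be empty. *)
Lemma scaled_tail_extremal X (S C : {set V}) (sSC : S \subset C)
    (x : subvec R S) (t : R) :
  (forall u, standard_frechet1 (X u)) -> S != C -> 0 < t ->
  scaled_tail X (extremal_set sSC x) t = scaled_tail X (box_compl x) t.
Proof.
move=> Xfr neqSC t_gt0; rewrite /scaled_tail; congr (_ * fine _).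
have mE := measurable_scaled_extremal X sSC x t.
have mF := measurable_scaled_box_compl X x t.
(* Exceptional null set: off [N] all coordinates are positive and the two events agree. *)
pose N := \bigcup_(u in [set: V]) [set w | X u w <= 0].
have mle0 u : measurable [set w | X u w <= 0] by exact: measurable_RV_le.
have mN : measurable N by apply: fin_bigcup_measurable.
have PN : P N = 0%E.
  apply: measure_negligible => //.
  have : {ae P, forall w, forall u, 0 < X u w}.
    apply: filter_forall => u; exists [set w | X u w <= 0]; split => //.
      exact: standard_frechet1_le0.
    by move=> w /= /negP; rewrite -leNgt.
  apply: negligibleS => w [u _ /= Xu] /(_ u).
  by rewrite ltNge Xu.
(* The extremal event lies in the box-complement event everywhere; the reverse inclusion holds only
   after adding [N], which does not change the probability. *)
apply/eqP; rewrite eq_le; apply/andP; split.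
  by apply: le_measure; rewrite ?inE// => w [].
rewrite -(measureU0 mE mN PN); apply: le_measure; rewrite ?inE//.
  exact: measurableU.
move=> w Fw; have [Nw|Nw] := pselect (N w); [by right|left].
have Xgt0 u : 0 < X u w.
  by rewrite ltNge; apply/negP => Xu; apply: Nw; exists u.
split => //; split => [u|].
  by rewrite /restr /scaled_subvec /= divr_ge0// ltW.
(* A vertex of [C] outside [S] carries a positive coordinate, so the subvector on [C :\: S] is not
   zero. *)
have /properP[_ [v vC vS]] : S \proper C by rewrite finset.properEneq neqSC.
have vCS : v \in (C :\: S)%SET by rewrite inE vS vC.
move=> /(congr1 (fun f => f (exist _ v vCS))) /eqP.
by rewrite /restr /scaled_subvec /= gt_eqF// divr_gt0.
Qed.

End FrechetTails.

Theorem proposition2 (R : realType) (disp : measure_display)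
    (T : measurableType disp) (P : probability T R)
    (d : nat) (e : rel 'I_d) (X : 'I_d -> {RV P >-> R})
    (e_simple : simple_graph e) (e_decomposable : decomposable e)
    (X_model : graphical_model e X)
    (X_frechet : forall u : 'I_d, standard_frechet1 (X u))
    (C C' : {set 'I_d})
    (maxC : maximal_clique e C) (maxC' : maximal_clique e C')
    (neqCC' : C != C') (S_neq0 : (C :&: C')%SET != finset.set0)
    (x : subvec R (C :&: C')%SET) (x_gt0 : forall u, 0 < x u)
    (limS : cvg (scaled_tail X (box_compl x) t @[t --> +oo])) :
  let B := extremal_set (finset.subsetIl C C') x in
  let B' := extremal_set (finset.subsetIr C C') x in
  [/\ cvg (scaled_tail X B t @[t --> +oo]),
      cvg (scaled_tail X B' t @[t --> +oo]) &
      lim (scaled_tail X B t @[t --> +oo]) =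
      lim (scaled_tail X B' t @[t --> +oo])].
Proof.
(* If the intersection were [A], then [A] would lie in the clique [A'], and maximality of [A] would
   force [A = A']. *)
have meet_neq (A A' : {set 'I_d}) : maximal_clique e A -> maximal_clique e A' ->
    A != A' -> (A :&: A')%SET != A.
  move=> /maxsetP[_ maxA] /maxsetP[cA' _] neqAA'.
  apply: contra neqAA' => /eqP/finset.setIidPl sAA'.
  by rewrite (maxA _ cA' sAA').
move=> B B'.
(* Only eventual equality is available, since the tails are compared for t > 0. *)
have tailB : \forall t \near +oo,
    scaled_tail X (box_compl x) t = scaled_tail X B t.
  near=> t; rewrite scaled_tail_extremal//; exact: meet_neq.
have tailB' : \forall t \near +oo,
    scaled_tail X (box_compl x) t = scaled_tail X B' t.
  near=> t; rewrite scaled_tail_extremal//.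
  by rewrite finset.setIC; apply: meet_neq => //; rewrite eq_sym.
pose l := lim (scaled_tail X (box_compl x) t @[t --> +oo]).
(* [limS] is by definition convergence to [l], and it passes to any eventually equal function. *)
have cB : scaled_tail X B t @[t --> +oo] --> l.
  exact: cvg_trans (near_eq_cvg tailB) limS.
have cB' : scaled_tail X B' t @[t --> +oo] --> l.
  exact: cvg_trans (near_eq_cvg tailB') limS.
split; [exact: (cvgP _ cB)|exact: (cvgP _ cB')|].
by rewrite (cvg_lim _ cB) ?(cvg_lim _ cB').
Unshelve. all: by end_near. Qed.
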